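(* Let $n\in\mathbb Z$ and write $f_n=\mathfrak P_\varphi(\lambda^n\varphi_\lambda)=\sum_{i\ge1}f^{(i)}\lambda^i$, the coefficients $f^{(i)}$ being regarded as functions on the covering $\bar\tau_*$ via $\varphi^{(1)}=-y$, $\varphi^{(2)}=-x$, $\varphi^{(3)}=-z-\tfrac12y^2$. Put $$Z=(z_y+y)f^{(1)}+z_xf^{(2)}-f^{(3)},\qquad \Phi^{(k)}=f^{(k)}+f^{(2)}\varphi^{(k)}_x+f^{(1)}\varphi^{(k)}_y\quad(k\ge4),$$ and let $\mathcal S=\sum_X\tilde D_X(Z)\,\partial/\partial z_X+\sum_{k\ge4}\Phi^{(k)}\,\partial/\partial\varphi^{(k)}$, the first sum running over all internal coordinates $z_X$ ($X=x^a$ or $X=x^ay$, $a\ge0$) and $\tilde D_X=\tilde D_x^{a}\tilde D_y^{b}$ for $X=x^ay^b$. Then $\mathcal S$ is a (nonlocal) symmetry of the Gibbons–Tsarev equation in the covering $\bar\tau_*$, i.e. $[\mathcal S,\tilde D_x]=[\mathcal S,\tilde D_y]=0$.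
   Context: The Gibbons–Tsarev equation $\mathcal E$ is $z_{yy}+z_xz_{xy}-z_yz_{xx}+1=0$ for $z(x,y)$, taken with all differential consequences; internal coordinates are $x,y$ and $z_X=\partial^{a+b}z/\partial x^a\partial y^b$ for $X=x^ay^b$ with $b\in\{0,1\}$ (derivatives with $b\ge2$ are expressed through these using the equation); $D_x,D_y$ are the total derivatives. Put $\varphi^{(-1)}=1$, $\varphi^{(0)}=0$, $\varphi^{(1)}=-y$, $\varphi^{(2)}=-x$, $\varphi^{(3)}=-z-\tfrac12y^2$, let $\varphi^{(k)}$, $k\ge4$, be new coordinates, and let $\varphi(\lambda)=1/\lambda+\sum_{k\ge1}\varphi^{(k)}\lambda^k$ (formal Laurent series in a parameter $\lambda$), $\varphi_\lambda=d\varphi/d\lambda$. The covering $\bar\tau_*$ is the space with coordinates $x,y,z_X,\varphi^{(k)}$ ($k\ge4$) and commuting total derivatives $\tilde D_x=D_x+\sum_{k\ge4}\varphi^{(k)}_x\partial/\partial\varphi^{(k)}$, $\tilde D_y=D_y+\sum_{k\ge4}\varphi^{(k)}_y\partial/\partial\varphi^{(k)}$, where the functions $\varphi^{(k)}_x,\varphi^{(k)}_y$ (polynomials in $x,y,z,z_x,z_y,\varphi^{(4)},\dots,\varphi^{(k-1)}$) are uniquely determined by requiring that, with $\varphi_x=\sum_{k\ge1}\tilde D_x(\varphi^{(k)})\lambda^k$ and $\varphi_y=\sum_{k\ge1}\tilde D_y(\varphi^{(k)})\lambda^k$, the identities $(\varphi^2-z_x\varphi-z_y)\varphi_x=-1$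 and $(\varphi^2-z_x\varphi-z_y)\varphi_y=-(\varphi-z_x)$ hold coefficientwise in $\lambda$. Notation $\mathfrak P_\varphi$: let $w=1/\varphi(\lambda)=\lambda+O(\lambda^3)$; any Laurent series $F$ in $\lambda$ with finitely many negative powers can be written uniquely as $F=\sum_{k\le m}c_k\varphi(\lambda)^k$ with $c_k$ independent of $\lambda$; put $P_\varphi F=\sum_{k=0}^mc_k\varphi^k$ and $\mathfrak P_\varphi F=F-P_\varphi F$, a power series in $\lambda$ without constant term whose coefficients are polynomials in the $\varphi^{(j)}$. *)

(* Defs.v *)
From HB Require Import structures.
From mathcomp Require Import all_boot all_order all_algebra.
From mathcomp Require Import finmap.
From mathcomp Require Import monalg.

Set Implicit Arguments.
Unset Strict Implicit.
Unset Printing Implicit Defensive.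

Import GRing.Theory.
Local Open Scope ring_scope.

(* Coordinates on the covering \bar\tau_* :
     x, y, z_X (X = x^a y^b, b \in {0,1}) and phi^(k), k >= 4.
   Encoding: inl (inl tt) = x, inl (inr tt) = y,
             inr (inl (a,b)) = z_{x^a y^b} (b = true means one y),
             inr (inr k) = phi^(k+4).                                  *)
Definition coord : choiceType := ((unit + unit) + ((nat * bool) + nat))%type.

Definition cx : coord := inl (inl tt).
Definition cy : coord := inl (inr tt).
Definition cz (a : nat) (b : bool) : coord := inr (inl (a, b)).
Definition cphi (k : nat) : coord := inr (inr k).   (* = phi^(k+4) *)

(* Smooth functions on the covering: polynomials with rational coefficients
   in (finitely many of) the coordinates. *)
Definition A := {malg rat[cmonom coord]}.

Definition var (c : coord) : A := << ucm c >>.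

Definition pd (c : coord) (p : A) : A :=
  \sum_(m <- msupp p) << (p@_m * ((m : cmonom coord) c)%:R) *g divcm m (ucm c) >>.

Definition vars (p : A) : seq coord :=
  undup (flatten [seq (enum_fset (finsupp (m : cmonom coord))) | m <- msupp p]).

Definition vfield (a : coord -> A) (p : A) : A :=
  \sum_(c <- vars p) a c * pd c p.

Definition X : A := var cx.
Definition Y : A := var cy.
Definition Z (a : nat) (b : bool) : A := var (cz a b).
Definition z0 := Z 0 false.
Definition zx := Z 1 false.
Definition zy := Z 0 true.

Definition Dx_coef (c : coord) : A :=
  match c with
  | inl (inl _) => 1
  | inl (inr _) => 0
  | inr (inl (a, b)) => Z a.+1 b
  | inr (inr _) => 0
  end.
Definition Dx (p : A) : A := vfield Dx_coef p.

(* z_yy expressed through the equation z_yy + z_x z_xy - z_y z_xx + 1 = 0 *)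
Definition zyy : A := zy * Z 2 false - zx * Z 1 true - 1.

Definition Dy_coef (c : coord) : A :=
  match c with
  | inl (inl _) => 0
  | inl (inr _) => 1
  | inr (inl (a, false)) => Z a true
  | inr (inl (a, true)) => iter a Dx zyy
  | inr (inr _) => 0
  end.
Definition Dy (p : A) : A := vfield Dy_coef p.

(* phi^(k) for k >= 0 (phi^(0) = 0, phi^(1) = -y, phi^(2) = -x,
   phi^(3) = -z - y^2/2, phi^(k) a coordinate for k >= 4);
   phi^(-1) = 1 is handled separately below. *)
Definition phik (k : nat) : A :=
  match k with
  | 0 => 0
  | 1 => - Y
  | 2 => - X
  | 3 => - z0 - 2%:R^-1 *: (Y * Y)
  | k'.+4 => var (cphi k')
  end.

(* total derivatives on the covering, given the functions
   phix k = phi^(k+4)_x and phiy k = phi^(k+4)_y *)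
Definition Dxt (phix : nat -> A) (p : A) : A :=
  vfield (fun c => match c with inr (inr k) => phix k | _ => Dx_coef c end) p.
Definition Dyt (phiy : nat -> A) (p : A) : A :=
  vfield (fun c => match c with inr (inr k) => phiy k | _ => Dy_coef c end) p.

(* Formal Laurent series in lambda with finitely many negative powers:
   Laurent m s  represents  lambda^(-m) * sum_{j>=0} s j lambda^j.     *)
Record laurent := Laurent { lord : nat; lser : nat -> A }.

Definition lcoef (F : laurent) (i : int) : A :=
  match (i + (lord F)%:Z)%R with
  | Posz j => lser F j
  | Negz _ => 0
  end.

Definition ladd (F G : laurent) : laurent :=
  Laurent (lord F + lord G)
    (fun j => lcoef F (j%:Z - (lord F + lord G)%:Z) + lcoef G (j%:Z - (lord F + lord G)%:Z)).
Definition lopp (F : laurent) : laurent := Laurent (lord F) (fun j => - lser F j).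
Definition lmul (F G : laurent) : laurent :=
  Laurent (lord F + lord G)
    (fun i => \sum_(j < i.+1) lser F j * lser G (i - j)).
Definition lconst (c : A) : laurent := Laurent 0 (fun j => if j == 0 then c else 0).
Definition lscale (c : A) (F : laurent) : laurent := lmul (lconst c) F.
Definition lpow (F : laurent) (n : nat) : laurent := iter n (lmul F) (lconst 1).
Definition ltimesX (n : int) (F : laurent) : laurent :=
  match n with
  | Posz k => Laurent (lord F) (fun j => if (k <= j)%N then lser F (j - k) else 0)
  | Negz k => Laurent (lord F + k.+1) (lser F)
  end.

(* phi(lambda) = 1/lambda + sum_{k>=1} phi^(k) lambda^k *)
Definition phiL : laurent :=
  Laurent 1 (fun j => if j == 0%N then 1 else phik j.-1).

(* phi_lambda = d phi / d lambda = -1/lambda^2 + sum_{k>=1} k phi^(k) lambda^(k-1) *)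
Definition phiLam : laurent :=
  Laurent 2 (fun j => if j == 0%N then -1 else (j.-1)%:R * phik j.-1).

Definition phixL (phix : nat -> A) : laurent :=
  Laurent 0 (fun k => Dxt phix (phik k)).
Definition phiyL (phiy : nat -> A) : laurent :=
  Laurent 0 (fun k => Dyt phiy (phik k)).

Definition Qphi : laurent :=
  ladd (ladd (lmul phiL phiL) (lscale (- zx) phiL)) (lconst (- zy)).

Definition covering_eqs (phix phiy : nat -> A) : Prop :=
  (forall i : int, lcoef (lmul Qphi (phixL phix)) i = lcoef (lconst (-1)) i) /\
  (forall i : int, lcoef (lmul Qphi (phiyL phiy)) i =
                   lcoef (lopp (ladd phiL (lconst (- zx)))) i).

(* The projection frakP_phi.  If F = sum_{k <= m} c_k phi^k, the c_k with
   k = m, m-1, ..., 0 are found successively as the coefficient of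
   lambda^(-k) in F - sum_{k < j <= m} c_j phi^j (because
   phi^k = lambda^(-k) (1 + O(lambda^2))).  [reduce k F] subtracts
   c_k phi^k, ..., c_0 phi^0 from F; hence
   frakP F = F - P_phi F = reduce (lord F) F. *)
Fixpoint reduce (k : nat) (F : laurent) : laurent :=
  let F' := ladd F (lopp (lscale (lcoef F (- k%:Z)) (lpow phiL k))) in
  match k with
  | 0 => F'
  | k'.+1 => reduce k' F'
  end.

Definition frakP (F : laurent) : laurent := reduce (lord F) F.

Definition fcoef (n : int) (i : nat) : A :=
  lcoef (frakP (ltimesX n phiLam)) i%:Z.

Definition Zgen (n : int) : A :=
  (zy + Y) * fcoef n 1 + zx * fcoef n 2 - fcoef n 3.

Definition PhiS (phix phiy : nat -> A) (n : int) (k : nat) : A :=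
  fcoef n (k + 4) + fcoef n 2 * phix k + fcoef n 1 * phiy k.

Definition S_coef (phix phiy : nat -> A) (n : int) (c : coord) : A :=
  match c with
  | inl _ => 0
  | inr (inl (a, b)) =>
      iter a (Dxt phix) (iter (nat_of_bool b) (Dyt phiy) (Zgen n))
  | inr (inr k) => PhiS phix phiy n k
  end.

Definition Ssym (phix phiy : nat -> A) (n : int) (p : A) : A :=
  vfield (S_coef phix phiy n) p.

(* Main.v *)
(** Write [S] in evolutionary form: on the generating series, [S phi = f + f2 phi_x + f1 phi_y].
Since [Q phi_x = -1] and [Q phi_y = -(phi - z_x)] with [Q = phi^2 - z_x phi - z_y], and since
[lam^n phi_lam] satisfies the linearised versions of these equations while it differs from
[f] by a polynomial in [phi], the series [Q^2 Delta_x] and [Q (Delta_y - (phi - z_x) Delta_x)],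
where [Delta_x = [D_x, S] phi] and [Delta_y = [D_y, S] phi], are polynomials in [phi] with
coefficients independent of [lam].  The definition of [Z] makes [Delta_x] and [Delta_y] of order
at least [lam^4].  A polynomial in [phi] that is a power series in [lam] is a constant, and one
without constant term vanishes; hence [Delta_y = (phi - z_x) Delta_x] and [Q^2 Delta_x] is a
constant [c].  Then [Delta_y = c lam^3 + O(lam^4)], so [c = 0].

So [S] commutes with [D_x].  The derivation [[D_y, S]] then commutes with [D_x] and kills
[phi], hence [phi_x], hence [Q], hence [z_x] and [z_y], hence all the [z_X].

To stay inside power series, every polynomial in [phi] is multiplied by a power of [lam]:
[lam phi] becomes [u], [lam (phi - z_x)] becomes [w], [lam^2 Q] becomes [Q],
[lam^2 phi_lam] becomes [v], and polynomials of degree [N] in [phi] become homogeneous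
polynomials of degree [N] in [u] and [lam]. *)
From HB Require Import structures.
Require Import Defs.
From mathcomp Require Import all_boot all_order all_algebra.
From mathcomp Require Import monalg.
From mathcomp Require Import finmap boolp ring zify.

Set Implicit Arguments.
Unset Strict Implicit.
Unset Printing Implicit Defensive.

Import GRing.Theory.
Local Open Scope ring_scope.

(* [algebra.vector] also exports a [coord]. *)
Local Notation coord := Defs.coord.

(** * Formal power series *)

(** A bare function type, so that the coefficient function [lser F] of a Laurent series is itself a
    power series. *)
Definition fps (R : Type) : Type := nat -> R.

Section FpsRing.
Variable R : comNzRingType.
Implicit Types s t : fps R.

HB.instance Definition _ := gen_eqMixin (fps R).
HB.instance Definition _ := gen_choiceMixin (fps R).

Definition fps_zero : fps R := fun=> 0.
Definition fps_opp s : fps R := fun i => - s i.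
Definition fps_add s t : fps R := fun i => s i + t i.
Definition fps_one : fps R := fun i => (i == 0)%:R.
Definition fps_mul s t : fps R := fun i => \sum_(j < i.+1) s j * t (i - j)%N.

Fact fps_addA : associative fps_add.
Proof. by move=> s t r; apply: funext => i; rewrite /fps_add addrA. Qed.
Fact fps_addC : commutative fps_add.
Proof. by move=> s t; apply: funext => i; rewrite /fps_add addrC. Qed.
Fact fps_add0 : left_id fps_zero fps_add.
Proof. by move=> s; apply: funext => i; rewrite /fps_add add0r. Qed.
Fact fps_addN : left_inverse fps_zero fps_opp fps_add.
Proof. by move=> s; apply: funext => i; rewrite /fps_add addNr. Qed.

HB.instance Definition _ :=
  GRing.isZmodule.Build (fps R) fps_addA fps_addC fps_add0 fps_addN.

(* The multiplicative axioms are inherited from {poly R} through truncation. *)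
Definition fps_trunc n s : {poly R} := \poly_(i < n) s i.

Lemma coef_fps_mul n s t i : (i < n)%N ->
  fps_mul s t i = (fps_trunc n s * fps_trunc n t)`_i.
Proof.
move=> lt_in; rewrite coefM; apply: eq_bigr => j _.
by rewrite !coef_poly (leq_ltn_trans _ lt_in) 1?(leq_ltn_trans _ lt_in) ?leq_subr // -ltnS.
Qed.

Lemma coef_trunc_mul n s t i : (i < n)%N ->
  (fps_trunc n (fps_mul s t))`_i = (fps_trunc n s * fps_trunc n t)`_i.
Proof. by move=> lt_in; rewrite coef_poly lt_in (coef_fps_mul s t lt_in). Qed.

Fact fps_mulC : commutative fps_mul.
Proof.
by move=> s t; apply: funext => i; rewrite !(coef_fps_mul _ _ (ltnSn i)) mulrC.
Qed.
Fact fps_mulA : associative fps_mul.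
Proof.
move=> s t r; apply: funext => i; rewrite !(coef_fps_mul _ _ (ltnSn i)).
transitivity ((fps_trunc i.+1 s * (fps_trunc i.+1 t * fps_trunc i.+1 r))`_i).
  rewrite !coefM; apply: eq_bigr => j _; congr (_ * _).
  by rewrite coef_trunc_mul // ltnS leq_subr.
rewrite mulrA !coefM; apply: eq_bigr => j _; congr (_ * _).
by rewrite coef_trunc_mul.
Qed.
Fact fps_mul1 : left_id fps_one fps_mul.
Proof.
move=> s; apply: funext => i; rewrite /fps_mul big_ord_recl mul1r subn0.
by rewrite big1 ?addr0 // => j _; rewrite mul0r.
Qed.
Fact fps_mulDl : left_distributive fps_mul fps_add.
Proof.
move=> s t r; apply: funext => i; rewrite /fps_mul /fps_add -big_split.
by apply: eq_bigr => j _; rewrite mulrDl.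
Qed.
Fact fps_one_neq0 : fps_one != 0.
Proof.
by apply/eqP => /(congr1 (fun s : fps R => s 0)) /eqP; rewrite /fps_one oner_eq0.
Qed.

HB.instance Definition _ := GRing.Zmodule_isComNzRing.Build (fps R)
  fps_mulA fps_mulC fps_mul1 fps_mulDl fps_one_neq0.

Lemma fpsP s t : (forall i, s i = t i) -> s = t.
Proof. exact: funext. Qed.
Lemma fpsDE s t i : (s + t) i = s i + t i. Proof. by []. Qed.
Lemma fpsBE s t i : (s - t) i = s i - t i. Proof. by []. Qed.
Lemma fps1E i : (1 : fps R) i = (i == 0)%:R. Proof. by []. Qed.
Lemma fpsME s t i : (s * t) i = \sum_(j < i.+1) s j * t (i - j)%N. Proof. by []. Qed.
Lemma fpsM0E s t : (s * t) 0 = s 0 * t 0.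
Proof. by rewrite fpsME big_ord1. Qed.

Definition cst (c : R) : fps R := fun i => if i == 0 then c else 0.
Definition lam : fps R := fun i => (i == 1)%:R.

Lemma cstME c s i : (cst c * s) i = c * s i.
Proof.
by rewrite fpsME big_ord_recl subn0 big1 ?addr0 // => j _; rewrite mul0r.
Qed.

Fact cst_is_additive : additive cst.
Proof. by move=> a b; apply: fpsP => -[|i]; rewrite fpsBE //= subr0. Qed.
HB.instance Definition _ := GRing.isAdditive.Build R (fps R) cst cst_is_additive.
Fact cst_is_multiplicative : multiplicative cst.
Proof.
by split=> [a b|]; apply: fpsP => -[|i] //; rewrite cstME //= mulr0.
Qed.
HB.instance Definition _ :=
  GRing.isMultiplicative.Build R (fps R) cst cst_is_multiplicative.

Lemma lamME s i : (lam * s) i = if i is j.+1 then s j else 0.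
Proof.
case: i => [|i]; first by rewrite fpsM0E mul0r.
rewrite fpsME big_ord_recl mul0r add0r big_ord_recl mul1r subn1.
by rewrite big1 ?addr0 // => j _; rewrite mul0r.
Qed.
Lemma lamXE k s i : (lam ^+ k * s) i = if (k <= i)%N then s (i - k)%N else 0.
Proof.
elim: k i => [|k IH] [|i]; rewrite ?mul1r ?subn0 // exprS -mulrA lamME //.
Qed.

Lemma lamX_inj k : injective (fun s => lam ^+ k * s).
Proof.
move=> s t eq_st; apply: fpsP => i.
by have /(congr1 (fun r : fps R => r (k + i)%N)) := eq_st; rewrite !lamXE leq_addr addKn.
Qed.
Lemma lamM_inj : injective ( *%R lam).
Proof. by have := @lamX_inj 1; rewrite expr1. Qed.

Lemma lamXP k s : (forall i, (i < k)%N -> s i = 0) -> exists t, s = lam ^+ k * t.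
Proof.
move=> s0; exists (fun i => s (k + i)%N); apply: fpsP => i.
by rewrite lamXE; case: leqP => [/subnKC->|/s0].
Qed.

(** Coefficient [i] of [q * s] is [s i] plus terms in earlier coefficients of [s], so strong
    induction applies. This stands in for division by [Q]. *)
Lemma fps_unit_reg (q s : fps R) : q 0 = 1 -> q * s = 0 -> s = 0.
Proof.
move=> q0 qs0; apply: fpsP; elim/ltn_ind => i IH.
have := congr1 (fun r : fps R => r i) qs0.
rewrite fpsME big_ord_recl q0 mul1r subn0 big1 ?addr0 // => j _.
by rewrite IH ?mulr0 // ltn_subrL; case: (i) j => // -[].
Qed.

End FpsRing.
Arguments lam {R}.

(** * Derivations acting on power series *)

Section Derivations.
Variable R : comNzRingType.
Implicit Types (D : R -> R) (s t : fps R).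

Definition derivation (B : comNzRingType) (D : B -> B) :=
  {morph D : a b / a + b} /\ forall a b, D (a * b) = D a * b + a * D b.

Section DerivationTheory.
Variables (B : comNzRingType) (D : B -> B) (dD : derivation D).
Lemma derD a b : D (a + b) = D a + D b. Proof. exact: dD.1. Qed.
Lemma derM a b : D (a * b) = D a * b + a * D b. Proof. exact: dD.2. Qed.
Lemma der0 : D 0 = 0.
Proof. by apply: (addrI (D 0)); rewrite -derD !addr0. Qed.
Lemma derN a : D (- a) = - D a.
Proof. by apply: (addrI (D a)); rewrite -derD !subrr der0. Qed.
Lemma derB a b : D (a - b) = D a - D b.
Proof. by rewrite derD derN. Qed.
Lemma der1 : D 1 = 0.
Proof. by apply: (addrI (D 1)); rewrite addr0 -[in RHS](mulr1 1) derM mulr1 mul1r. Qed.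
Lemma derMn a n : D (a *+ n) = D a *+ n.
Proof. by elim: n => [|n IH]; rewrite ?mulr0n ?der0 // !mulrS derD IH. Qed.
Lemma der_sum (I : Type) (r : seq I) (P : pred I) (F : I -> B) :
  D (\sum_(i <- r | P i) F i) = \sum_(i <- r | P i) D (F i).
Proof. exact: (big_morph D derD der0). Qed.
End DerivationTheory.

Lemma commutator_derivation (B : comNzRingType) (D E : B -> B) :
  derivation D -> derivation E -> derivation (fun a => D (E a) - E (D a)).
Proof.
move=> dD dE; split=> a b; first by rewrite !(derD dD, derD dE); ring.
by rewrite !(derM dD, derM dE, derD dD, derD dE); ring.
Qed.

Definition dmap D s : fps R := D \o s.
Definition dlam s : fps R := fun i => i.+1%:R * s i.+1.

Lemma dmapE D s i : dmap D s i = D (s i). Proof. by []. Qed.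

Lemma dmap_derivation D : derivation D -> derivation (dmap D).
Proof.
move=> dD; split=> s t; apply: fpsP => i; first exact: derD.
rewrite dmapE fpsDE !fpsME (der_sum dD) -big_split /=.
by apply: eq_bigr => j _; rewrite derM.
Qed.

Lemma dmap_cst D c : derivation D -> dmap D (cst c) = cst (D c).
Proof. by move=> dD; apply: fpsP => -[|i] //=; rewrite dmapE der0. Qed.
Lemma dmap_lam D : derivation D -> dmap D lam = 0.
Proof.
by move=> dD; apply: fpsP => -[|[|i]]; rewrite dmapE /lam /= ?der0 ?der1.
Qed.
Lemma dlam_dmap D s : derivation D -> dlam (dmap D s) = dmap D (dlam s).
Proof.
by move=> dD; apply: fpsP => i; rewrite /dlam !dmapE !mulr_natl derMn.
Qed.

Lemma dlam_derivation : derivation dlam.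
Proof.
split=> s t; apply: fpsP => i; first by rewrite /dlam fpsDE mulrDr.
(* Coefficient [i] of a derivative involves coefficient [i.+1] of the series, so truncating at
   [i.+2] reduces the claim to polynomials. *)
have coefP r j : (j <= i)%N -> r j = (fps_trunc i.+2 r)`_j.
  by move=> le_ji; rewrite coef_poly ltnS (leqW le_ji).
have coefP' r j : (j <= i)%N -> dlam r j = ((fps_trunc i.+2 r)^`())`_j.
  by move=> le_ji; rewrite coef_deriv coef_poly !ltnS le_ji /dlam mulr_natl.
have -> : dlam (s * t) i = ((fps_trunc i.+2 s * fps_trunc i.+2 t)^`())`_i.
  by rewrite coef_deriv -mulr_natl -coef_fps_mul.
rewrite derivM coefD fpsDE.
by rewrite !coefM !fpsME; congr (_ + _); apply: eq_bigr => j _;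
   rewrite -?coefP -?coefP' ?leq_subr // -ltnS.
Qed.
Lemma dlam_cst c : dlam (cst c) = 0.
Proof. by apply: fpsP => i; rewrite /dlam mulr0. Qed.
Lemma dlam_lam : dlam lam = 1 :> fps R.
Proof. by apply: fpsP => -[|i]; rewrite /dlam ?mulr1 // mulr0. Qed.
End Derivations.

(** * Homogeneous polynomials in [u] and [lam] *)

Section Homogeneous.
Variables (R : comNzRingType) (u : fps R).

(** In terms of u/lam, [F] is lam^N times a polynomial of degree at most [N] whose coefficients are
    free of lam. Closure rules allow degree bounds to be proved by induction, without naming
    coefficients. *)
Inductive homog : nat -> fps R -> Prop :=
| homog_cst c : homog 0 (cst c)
| homog_u N F : homog N F -> homog N.+1 (u * F)
| homog_lam N F : homog N F -> homog N.+1 (lam * F)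
| homogD N F G : homog N F -> homog N G -> homog N (F + G).

Lemma homogZ N c F : homog N F -> homog N (cst c * F).
Proof.
elim=> [d|M G _ IH|M G _ IH|M G H _ IHG _ IHH].
- by rewrite -rmorphM; exact: homog_cst.
- by rewrite mulrCA; exact: homog_u.
- by rewrite mulrCA; exact: homog_lam.
- by rewrite mulrDr; exact: homogD.
Qed.

Lemma homogN N F : homog N F -> homog N (- F).
Proof. by move/(homogZ (-1)); rewrite rmorphN rmorph1 mulN1r. Qed.

Lemma homogB N F G : homog N F -> homog N G -> homog N (F - G).
Proof. by move=> hF /homogN; exact: homogD. Qed.

Lemma homogM N M F G : homog N F -> homog M G -> homog (N + M) (F * G).
Proof.
move=> hF hG; elim: hF => [c|K F' _ IH|K F' _ IH|K F1 F2 _ IH1 _ IH2].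
- exact: homogZ.
- by rewrite -mulrA; exact: homog_u.
- by rewrite -mulrA; exact: homog_lam.
- by rewrite mulrDl; exact: homogD.
Qed.

Lemma homog1 : homog 0 1.
Proof. by rewrite -(rmorph1 (@cst R)); exact: homog_cst. Qed.
Lemma homog0 N : homog N 0.
Proof.
elim: N => [|N /homog_u]; last by rewrite mulr0.
by rewrite -(rmorph0 (@cst R)); exact: homog_cst.
Qed.
Lemma homog_uE : homog 1 u.
Proof. by rewrite -[u]mulr1; exact: homog_u homog1. Qed.
Lemma homog_lamE : homog 1 lam.
Proof. by rewrite -[lam]mulr1; exact: homog_lam homog1. Qed.
Lemma homogX N F k : homog N F -> homog (N * k) (F ^+ k).
Proof.
move=> hF; elim: k => [|k IH]; first by rewrite muln0; exact: homog1.
by rewrite mulnS exprS; exact: homogM.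
Qed.
Lemma homog_lamX k N F : homog N F -> homog (k + N) (lam ^+ k * F).
Proof.
by move=> hF; apply: homogM => //; have := homogX k homog_lamE; rewrite mul1n.
Qed.

(** The power u^N is the only monomial not divisible by [lam]. In degree 0 there is no remainder and
    [G] is a dummy. *)
Lemma homog_lead N F : homog N F -> exists c G,
  homog N.-1 G /\ F = cst c * u ^+ N + (if N is 0 then 0 else lam * G).
Proof.
elim=> [c|M F' hF' [c [G [hG ->]]]|M F' hF' _|M F1 F2 _ [c [G [hG ->]]] _ [d [H [hH ->]]]].
- by exists c, 0; split; [exact: homog0|rewrite mulr1 addr0].
- case: M hG hF' => [|M] hG hF'.
    by exists c, 0; split; [exact: homog0|rewrite addr0 mulr0 addr0 mulr1 expr1 mulrC].
  exists c, (u * G); split; first exact: homog_u.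
  by rewrite mulrDr mulrCA -exprS (mulrCA u).
- by exists 0, F'; split; rewrite // rmorph0 mul0r add0r.
- exists (c + d), (G + H); split; first exact: homogD.
  by case: (M) => [|K]; rewrite rmorphD; ring.
Qed.

(* A polynomial in 1/lam without negative powers of lam is a constant. *)
Lemma homog_divlam N F : u 0 = 1 -> homog N F ->
  (forall i, (i < N)%N -> F i = 0) -> F = cst (F N) * lam ^+ N.
Proof.
move=> u0; elim: N F => [|N IH] F /homog_lead[c [G [hG ->]]] F0.
  by rewrite !mulr1 addr0.
(* As [u 0 = 1], the constant coefficient of [F] is [c]; once it vanishes, a factor [lam] splits off
   and the induction hypothesis applies to [G]. *)
have c0 : c = 0.
  have := F0 0 isT; rewrite fpsDE cstME lamME addr0.
  suff -> : (u ^+ N.+1) 0 = 1 by rewrite mulr1.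
  by elim: (N.+1) => // k IHk; rewrite exprS fpsM0E u0 IHk mulr1.
rewrite c0 rmorph0 mul0r !add0r in F0 *; rewrite lamME exprS mulrCA -IH //.
by move=> i lt_iN; have := F0 i.+1 lt_iN; rewrite lamME.
Qed.
End Homogeneous.

(** * The linearised covering equations *)

Section GibbonsTsarev.
Variables (R : comNzRingType) (Dx Dy : R -> R) (Phi u w Q v : fps R) (zx zy : R).
Hypotheses (dDx : derivation Dx) (dDy : derivation Dy).
Hypotheses (uE : u = 1 + lam * Phi) (wE : w = u - cst zx * lam).
Hypotheses (QE : Q = u * w - cst zy * lam ^+ 2) (vE : v = lam * dlam u - u).
Local Notation phix := (dmap Dx Phi).
Local Notation phiy := (dmap Dy Phi).
(** The covering equations times lam^2. Since 1/lam is constant, the derivatives of phi are those of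
    its regular part [Phi]. *)
Hypothesis phixE : Q * phix = - lam ^+ 2.
Hypothesis phiyE : Q * phiy = - (lam * w).

Let u0 : u 0 = 1.
Proof. by rewrite uE fpsDE fps1E lamME addr0. Qed.
Let w0 : w 0 = 1.
Proof. by rewrite wE fpsBE u0 fpsM0E mulr0 subr0. Qed.
Let Q0 : Q 0 = 1.
Proof.
by rewrite QE fpsBE fpsM0E u0 w0 mulr1 mulrC lamXE subr0.
Qed.

Let Q_reg s t : Q * s = Q * t -> s = t.
Proof.
by move=> e; apply/subr0_eq/(fps_unit_reg Q0); rewrite mulrBr e subrr.
Qed.

(** This is phi_y = (phi - z_x) phi_x: both covering equations combined so that [Q] drops out. *)
Lemma lam_phiy : lam * phiy = w * phix.
Proof.
apply: Q_reg; transitivity (lam * (Q * phiy)); first by ring.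
by rewrite phiyE mulrCA phixE; ring.
Qed.

Section Derivation.
Variables (D : R -> R) (dD : derivation D).
Let dd := dmap_derivation dD.

Lemma der_u : dmap D u = lam * dmap D Phi.
Proof. by rewrite uE (derD dd) (der1 dd) (derM dd) dmap_lam //; ring. Qed.

Lemma der_w : dmap D w = lam * (dmap D Phi - cst (D zx)).
Proof.
by rewrite wE (derB dd) (derM dd) dmap_lam // dmap_cst // der_u; ring.
Qed.

Lemma der_Q : dmap D Q =
  lam * ((u + w) * dmap D Phi - cst (D zx) * u - cst (D zy) * lam).
Proof.
rewrite QE expr2 (derB dd) !(derM dd) dmap_lam // dmap_cst // der_u der_w.
by ring.
Qed.

(** Apply [D] to [phixE]; the further factor [Q] turns the remaining [phix] into a power of
    [lam]. *)
Lemma der_phix : Q ^+ 2 * dmap D phix =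
  lam ^+ 3 * ((u + w) * dmap D Phi - cst (D zx) * u - cst (D zy) * lam).
Proof.
have := congr1 (dmap D) phixE.
rewrite (derM dd) (derN dd) expr2 (derM dd) dmap_lam // der_Q => e.
transitivity (Q * (Q * dmap D phix)); first by ring.
have -> : Q * dmap D phix = - (lam *
  ((u + w) * dmap D Phi - cst (D zx) * u - cst (D zy) * lam) * phix).
  by apply/eqP; rewrite -addr_eq0 addrC e; apply/eqP; ring.
by rewrite mulrN [Q * _]mulrCA phixE; ring.
Qed.

Lemma der_phiy : lam * dmap D phiy =
  lam * (dmap D Phi - cst (D zx)) * phix + w * dmap D phix.
Proof.
have := congr1 (dmap D) lam_phiy.
by rewrite !(derM dd) dmap_lam // mul0r add0r der_w.
Qed.

(** By [der_phix], the series D(z_x) u + D(z_y) lam vanishes; its coefficients 0 and 1 give the two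
    claims in turn. Thus phi and phi_x determine z_x and z_y. *)
Lemma der_zxy0 : dmap D Phi = 0 -> dmap D phix = 0 -> D zx = 0 /\ D zy = 0.
Proof.
move=> D0 Dphix0; have := der_phix; rewrite D0 Dphix0 => e.
have {}e : cst (D zx) * u + lam * cst (D zy) = 0.
  by apply: (@lamX_inj R 3); apply/eqP; rewrite -subr_eq0 -oppr_eq0;
     apply/eqP; transitivity (Q ^+ 2 * 0); [rewrite e|]; ring.
have zx0 : D zx = 0.
  by have := congr1 (fun s : fps R => s 0) e;
     rewrite fpsDE cstME u0 mulr1 lamME addr0.
split=> //; have := congr1 (fun s : fps R => s 1) e.
by rewrite fpsDE cstME zx0 mul0r add0r lamME.
Qed.
End Derivation.

(** Compatibility of the covering. After multiplication by lam Q^2 both sides are given by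
    [der_phix], and they agree by the Gibbons-Tsarev equation, the second hypothesis. *)
Lemma phixy_comm : Dy zx = Dx zy -> Dy zy = zy * Dx zx - zx * Dx zy - 1 ->
  dmap Dx phiy = dmap Dy phix.
Proof.
move=> Dy_zx Dy_zy.
apply: (@lamM_inj R); apply: Q_reg; apply: Q_reg.
rewrite (der_phiy dDx).
transitivity (lam * (Q * phix) ^+ 2 - lam * cst (Dx zx) * Q * (Q * phix)
   + w * (Q ^+ 2 * dmap Dx phix)); first by ring.
transitivity (lam * (Q ^+ 2 * dmap Dy phix)); last by ring.
rewrite (der_phix dDx) (der_phix dDy) phixE Dy_zx Dy_zy.
rewrite !(rmorphB, rmorphM, rmorph1) /=.
transitivity (lam ^+ 5 + lam ^+ 3 * cst (Dx zx) * Q + lam ^+ 3 * ((u + w) * (w * phix)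
  - w * (cst (Dx zx) * u + cst (Dx zy) * lam))); first by ring.
by rewrite -lam_phiy QE wE; ring.
Qed.

(** * Degrees of total derivatives, and the linearised equations for phi_lam *)

Let homog_w : homog u 1 w.
Proof.
by rewrite wE; apply: homogB (homog_uE u) _; apply: homogZ (homog_lamE u).
Qed.

Let homog_Q : homog u 2 Q.
Proof.
rewrite QE; apply: homogB; first exact: (homogM (homog_uE u) homog_w).
by apply: homogZ; exact: (homogM (homog_lamE u) (homog_lamE u)).
Qed.

(** Among the generators only [u] and the constants are moved by [D], and the factor [Q] clears the
    denominator of the derivative of [u]. *)
Lemma homog_der (D : R -> R) N F : derivation D ->
  homog u 3 (Q * dmap D u) -> homog u N F -> homog u N.+2 (Q * dmap D F).
Proof.
move=> dD hDu; have dd := dmap_derivation dD.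
elim=> [c|M G hG IH|M G _ IH|M G H _ IHG _ IHH].
- by rewrite dmap_cst // mulrC; apply: homogZ.
- rewrite (derM dd) mulrDr mulrA mulrCA; apply: homogD; last exact: homog_u.
  by have := homogM hDu hG.
- by rewrite (derM dd) dmap_lam // mul0r add0r mulrCA; exact: homog_lam.
- by rewrite (derD dd) mulrDr; exact: homogD.
Qed.

Let homog_Dx N F : homog u N F -> homog u N.+2 (Q * dmap Dx F).
Proof.
move=> hF; apply: homog_der => //; rewrite der_u // mulrCA phixE.
have -> : lam * - lam ^+ 2 = - (lam ^+ 3 * 1) :> fps R by ring.
by apply: homogN; exact: (homog_lamX 3 (homog1 u)).
Qed.

Let homog_Dy N F : homog u N F -> homog u N.+2 (Q * dmap Dy F).
Proof.
move=> hF; apply: homog_der => //; rewrite der_u // mulrCA phiyE.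
have -> : lam * - (lam * w) = - (lam ^+ 2 * w) :> fps R by ring.
by apply: homogN; exact: (homog_lamX 2 homog_w).
Qed.

Let vwE : lam * dlam w - w = v.
Proof.
rewrite vE wE (derB (@dlam_derivation R)) (derM (@dlam_derivation R)).
by rewrite dlam_cst dlam_lam; ring.
Qed.

Let der_v (D : R -> R) : derivation D ->
  dmap D v = lam ^+ 2 * dlam (dmap D Phi).
Proof.
move=> dD; have dd := dmap_derivation dD.
rewrite vE (derB dd) (derM dd) dmap_lam // -dlam_dmap // der_u //.
by rewrite (derM (@dlam_derivation R)) dlam_lam; ring.
Qed.

(** The covering equations depend on lam only through phi. Applying [dlam] therefore gives the
    linearised equation of [der_phix] for phi_lam, without the terms varying z_x and z_y. *)
Let Dx_v : Q ^+ 2 * dmap Dx v = lam ^+ 3 * (u + w) * v.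
Proof.
have dl := @dlam_derivation R.
(* Here [Q] is lam^2 times a polynomial in phi; subtracting [Q *+ 2] removes the derivative of the
   factor lam^2. *)
have dQ : lam * dlam Q - Q *+ 2 = (u + w) * v.
  have -> : (u + w) * v = u * (lam * dlam w - w) + w * (lam * dlam u - u).
    by rewrite vwE -vE; ring.
  by rewrite QE expr2 (derB dl) !(derM dl) dlam_cst dlam_lam; ring.
have := congr1 (@dlam R) phixE.
rewrite (derM dl) (derN dl) expr2 (derM dl) dlam_lam => e.
rewrite (der_v dDx).
transitivity (lam ^+ 2 * Q * (dlam Q * phix + Q * dlam phix)
  - lam ^+ 2 * dlam Q * (Q * phix)); first by ring.
by rewrite e phixE -[RHS]mulrA -dQ; ring.
Qed.

(** The lam-derivative of [lam_phiy], to be compared with [der_phiy]. *)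
Let Dxy_v : lam * dmap Dy v - w * dmap Dx v = lam * v * phix.
Proof.
have dl := @dlam_derivation R.
have := congr1 (@dlam R) lam_phiy; rewrite !(derM dl) dlam_lam mul1r => e.
rewrite !der_v //.
transitivity (lam ^+ 2 * (phiy + lam * dlam phiy) - lam * (lam * phiy)
  - lam ^+ 2 * w * dlam phix); first by ring.
by rewrite e lam_phiy -vwE; ring.
Qed.

(** * The commutators with S on phi as polynomials in phi *)

Section Symmetry.
Variables (S : R -> R) (dS : derivation S) (a b : R) (f F : fps R) (K e : nat).
Hypothesis phixyC : dmap Dx phiy = dmap Dy phix.
(** The series [f] is lam^n phi_lam minus a polynomial in phi, with n = e - K + 2; two natural
    exponents accommodate negative n. *)
Hypotheses (fE : lam ^+ K * f = lam ^+ e * v - F) (homF : homog u K F).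
Hypothesis sE : dmap S Phi = f + cst a * phix + cst b * phiy.

Let Delta_x := dmap Dx (dmap S Phi) - dmap S phix.
Let Delta_y := dmap Dy (dmap S Phi) - dmap S phiy.

Let der_lamX (D : R -> R) k : derivation D -> dmap D (lam ^+ k) = 0.
Proof.
move=> dD; have dd := dmap_derivation dD.
elim: k => [|k IH]; first exact: der1.
by rewrite exprS (derM dd) IH dmap_lam // mul0r mulr0 addr0.
Qed.

Let der_fE (D : R -> R) : derivation D ->
  lam ^+ K * dmap D f = lam ^+ e * dmap D v - dmap D F.
Proof.
move=> dD; have dd := dmap_derivation dD.
have := congr1 (dmap D) fE.
by rewrite (derB dd) !(derM dd) !der_lamX // !mul0r !add0r.
Qed.

Let der_s (D : R -> R) : derivation D -> dmap D (dmap S Phi) = dmap D f +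
  (cst (D a) * phix + cst a * dmap D phix) + (cst (D b) * phiy + cst b * dmap D phiy).
Proof.
move=> dD; have dd := dmap_derivation dD.
by rewrite sE !(derD dd) !(derM dd) !dmap_cst.
Qed.

(** The part of [f] coming from [v] solves the linearised equation and drops out; what is left comes
    from [F], from the variations of z_x and z_y, and from the derivatives of [a] and [b]. *)
Lemma homog_Delta_x : homog u (K + 4) (lam ^+ K * (Q ^+ 2 * Delta_x)).
Proof.
(* The variations of z_x and z_y after removal of the transport by a D_x + b D_y, which preserves
   the covering equations. *)
pose cu := S zx - a * Dx zx - b * Dy zx.
pose cl := S zy - a * Dx zy - b * Dy zy.
pose T := lam ^+ 3 * (cst cu * u) + lam ^+ 4 * cst cl - lam ^+ 2 * (cst (Dx a) * Q)
  - lam ^+ 1 * (cst (Dx b) * (Q * w)).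
have QD : Q ^+ 2 * Delta_x = Q ^+ 2 * dmap Dx f - lam ^+ 3 * (u + w) * f + T.
  rewrite /Delta_x der_s // phixyC.
  transitivity (Q ^+ 2 * dmap Dx f + cst (Dx a) * Q * (Q * phix)
    + cst (Dx b) * Q * (Q * phiy) + cst a * (Q ^+ 2 * dmap Dx phix)
    + cst b * (Q ^+ 2 * dmap Dy phix) - Q ^+ 2 * dmap S phix); first by ring.
  rewrite !der_phix // phixE phiyE sE /T /cu /cl !(rmorphB, rmorphM) /=.
  by ring.
have -> : lam ^+ K * (Q ^+ 2 * Delta_x) =
    lam ^+ 3 * ((u + w) * F) - Q * (Q * dmap Dx F) + lam ^+ K * T.
  rewrite QD.
  transitivity (Q ^+ 2 * (lam ^+ K * dmap Dx f)
    - lam ^+ 3 * (u + w) * (lam ^+ K * f) + lam ^+ K * T); first by ring.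
  rewrite der_fE // fE.
  transitivity (lam ^+ e * (Q ^+ 2 * dmap Dx v) - Q * (Q * dmap Dx F)
    - lam ^+ 3 * (u + w) * (lam ^+ e * v - F) + lam ^+ K * T); first by ring.
  (* The multiples of [v] cancel here. *)
  by rewrite Dx_v; ring.
apply: homogD; last apply: homog_lamX.
  apply: homogB.
    rewrite addnC; apply: (homog_lamX 3).
    exact: homogM (homogD (homog_uE u) homog_w) homF.
  by rewrite addnC; apply: (homogM homog_Q); apply: homog_Dx.
apply: homogB; [apply: homogB; [apply: homogD|]|].
- by apply: (homog_lamX 3); apply: homogZ; exact: homog_uE.
- exact: (homog_lamX 4 (homog_cst u cl)).
- by apply: (homog_lamX 2); exact: homogZ.
- by apply: (homog_lamX 1); apply: homogZ; exact: (homogM homog_Q homog_w).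
Qed.

(** The same cancellation for the relation [lam_phiy], now by [Dxy_v]; a single factor [Q] suffices
    because that relation is free of [Q]. *)
Lemma homog_Delta_xy :
  homog u (K + 3) (lam ^+ K * (Q * (lam * Delta_y - w * Delta_x))).
Proof.
pose c := Dy a - a * Dx zx - b * Dy zx + S zx.
pose T := lam ^+ 2 * (cst (Dx a - Dy b) * w) + lam ^+ 1 * (cst (Dx b) * (w * w))
  - lam ^+ 3 * cst c.
have QD : Q * (lam * Delta_y - w * Delta_x) =
    Q * (lam * dmap Dy f - w * dmap Dx f) + lam ^+ 3 * f + T.
  rewrite /Delta_x /Delta_y !der_s // phixyC.
  transitivity (Q * (lam * dmap Dy f - w * dmap Dx f)
    + cst (Dy a) * lam * (Q * phix) + cst (Dy b) * lam * (Q * phiy)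
    - cst (Dx a) * w * (Q * phix) - cst (Dx b) * w * (Q * phiy)
    + cst a * Q * (lam * dmap Dx phiy - w * dmap Dx phix)
    + cst b * Q * (lam * dmap Dy phiy - w * dmap Dy phix)
    - Q * (lam * dmap S phiy - w * dmap S phix)).
    by rewrite phixyC; ring.
  rewrite !der_phiy // sE.
  transitivity (Q * (lam * dmap Dy f - w * dmap Dx f)
    + cst (Dy a) * lam * (Q * phix) + cst (Dy b) * lam * (Q * phiy)
    - cst (Dx a) * w * (Q * phix) - cst (Dx b) * w * (Q * phiy)
    - lam * (Q * phix) * (f + cst a * cst (Dx zx) + cst b * cst (Dy zx) - cst (S zx))).
    by ring.
  by rewrite phixE phiyE /T /c !(rmorphB, rmorphD, rmorphM) /=; ring.
have -> : lam ^+ K * (Q * (lam * Delta_y - w * Delta_x)) =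
    w * (Q * dmap Dx F) - lam ^+ 1 * (Q * dmap Dy F) - lam ^+ 3 * F + lam ^+ K * T.
  rewrite QD.
  transitivity (Q * (lam * (lam ^+ K * dmap Dy f) - w * (lam ^+ K * dmap Dx f))
    + lam ^+ 3 * (lam ^+ K * f) + lam ^+ K * T); first by ring.
  rewrite !der_fE // fE.
  transitivity (lam ^+ e * Q * (lam * dmap Dy v - w * dmap Dx v)
    - Q * (lam * dmap Dy F - w * dmap Dx F)
    + lam ^+ 3 * (lam ^+ e * v - F) + lam ^+ K * T); first by ring.
  rewrite Dxy_v.
  transitivity (lam ^+ e * lam * v * (Q * phix)
    - Q * (lam * dmap Dy F - w * dmap Dx F)
    + lam ^+ 3 * (lam ^+ e * v - F) + lam ^+ K * T); first by ring.
  by rewrite phixE; ring.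
apply: homogD; last apply: homog_lamX.
  rewrite addnC; apply: homogB; last exact: (homog_lamX 3).
  apply: homogB; last by apply: (homog_lamX 1); apply: homog_Dy.
  by apply: (homogM homog_w); apply: homog_Dx.
apply: homogB; last exact: (homog_lamX 3 (homog_cst u c)).
apply: homogD; first by apply: (homog_lamX 2); exact: homogZ.
by apply: (homog_lamX 1); apply: homogZ; exact: (homogM homog_w homog_w).
Qed.

Hypothesis Dx4 : forall i, (i < 4)%N -> Delta_x i = 0.
Hypothesis Dy4 : forall i, (i < 4)%N -> Delta_y i = 0.

Lemma S_comm_Phi : Delta_x = 0 /\ Delta_y = 0.
Proof.
have [dx dxE] := lamXP Dx4; have [dy dyE] := lamXP Dy4.
(* The degree is [K + 3] and the order of vanishing at least [K + 4], so even the constant left by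
   [homog_divlam] is zero. *)
have wDx : lam * Delta_y = w * Delta_x.
  apply/subr0_eq; apply: (fps_unit_reg Q0); apply: (@lamX_inj R K).
  have e1 : lam ^+ K * (Q * (lam * Delta_y - w * Delta_x)) =
      lam ^+ (K + 4) * (Q * (lam * dy - w * dx)).
    by rewrite dxE dyE exprD; ring.
  have := homog_divlam u0 homog_Delta_xy; rewrite e1 mulr0 => -> //.
    by rewrite lamXE addnS leqNgt ltnSn rmorph0 mul0r.
  by move=> i lt_i; rewrite lamXE leqNgt addnS ltnS ltnW.
(* Now the degree and the bound on the order are both [K + 4], so a constant survives; it equals
   [dx 0] because [Q 0 = 1]. *)
have cE : Q ^+ 2 * dx = cst (dx 0).
  apply: (@lamX_inj R (K + 4)).
  have e1 : lam ^+ K * (Q ^+ 2 * Delta_x) = lam ^+ (K + 4) * (Q ^+ 2 * dx).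
    by rewrite dxE exprD; ring.
  have := homog_divlam u0 homog_Delta_x; rewrite e1 => -> //; last first.
    by move=> i lt_i; rewrite lamXE leqNgt lt_i.
  by rewrite lamXE leqnn subnn fpsM0E expr2 fpsM0E Q0 !mul1r mulrC.
(* Dividing [wDx] by lam^4 leaves a left side without constant term, whereas [w 0 = 1]. *)
have dx0 : dx 0 = 0.
  have : lam * dy = w * dx.
    by apply: (@lamX_inj R 4); rewrite mulrCA -dyE wDx dxE mulrCA.
  by move/(congr1 (fun s : fps R => s 0)); rewrite lamME fpsM0E w0 mul1r.
have dx_0 : Delta_x = 0.
  apply: (fps_unit_reg Q0); apply: (fps_unit_reg Q0).
  transitivity (lam ^+ 4 * (Q ^+ 2 * dx)); first by rewrite dxE; ring.
  by rewrite cE dx0 rmorph0 mulr0.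
split=> //; apply: (@lamM_inj R); rewrite wDx dx_0; ring.
Qed.
End Symmetry.
End GibbonsTsarev.

(** * Derivations of the ring of functions *)

(* Identities are proved over an abstract ring and then instantiated: on [A] itself,
   unification may unfold the multiplication and diverge. *)
Lemma leibniz_addl (B : comNzRingType) (D : B -> B) p q r : {morph D : a b / a + b} ->
  D (p * r) = D p * r + p * D r -> D (q * r) = D q * r + q * D r ->
  D ((p + q) * r) = D (p + q) * r + (p + q) * D r.
Proof. by move=> DD e1 e2; rewrite mulrDl !DD e1 e2; ring. Qed.

Lemma leibniz_addr (B : comNzRingType) (D : B -> B) p q r : {morph D : a b / a + b} ->
  D (r * p) = D r * p + r * D p -> D (r * q) = D r * q + r * D q ->
  D (r * (p + q)) = D r * (p + q) + r * D (p + q).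
Proof. by move=> DD e1 e2; rewrite mulrDr !DD e1 e2; ring. Qed.

Lemma leibniz_scale (K : comNzRingType) (B : comAlgType K) (x y : K)
    (a b c d p q Dp Dq Dpq : B) :
  Dp = x *: a -> p = x *: b -> Dq = y *: c -> q = y *: d ->
  Dpq = (x * y) *: (a * d + b * c) -> Dpq = Dp * q + p * Dq.
Proof.
by move=> -> -> -> -> ->; rewrite -!scalerAl -!scalerAr !scalerA scalerDr.
Qed.

Lemma leibniz_mul (B : comNzRingType) (a p q Dp Dq Dpq : B) :
  Dpq = Dp * q + p * Dq -> a * Dpq = a * Dp * q + p * (a * Dq).
Proof. by move=> ->; ring. Qed.

Lemma derM_eq0 (B : comNzRingType) (D : B -> B) a b :
  derivation D -> D a = 0 -> D b = 0 -> D (a * b) = 0.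
Proof. by move=> dD Da Db; rewrite (derM dD) Da Db mul0r mulr0 addr0. Qed.

Section PolynomialDerivations.
Local Notation monom := (cmonom coord).
Implicit Types (c : coord) (m : monom) (p q : A).

Lemma malg_ind (P : A -> Prop) : (forall (x : rat) m, P << x *g m >>) ->
  (forall p q, P p -> P q -> P (p + q)) -> forall p, P p.
Proof.
move=> Pm PD p; rewrite (monalgE p); elim/big_rec: _ => [|m q _ Pq].
  by rewrite -(@monalgU0 monom rat mone).
exact: PD.
Qed.

Lemma malgMUU (x y : rat) m1 m2 :
  << x *g m1 >> * << y *g m2 >> = << x * y *g mmul m1 m2 >> :> A.
Proof. exact: fgmulUU. Qed.

(** The truncated division is harmless: if [c] does not occur in [m], the coefficient is zero. *)
Definition pd_monom c m : A := << (m c)%:R *g divcm m (ucm c) >>.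

(** Exhibits [pd c] as the linear extension of its values on monomials, whence additivity. *)
Lemma pdE c p : pd c p = mmap (@malgC monom rat) (pd_monom c) p.
Proof.
rewrite mmapE; apply: eq_bigr => m _; rewrite /pd_monom malgMUU.
by rewrite mul1m.
Qed.

Lemma pdU c (x : rat) m : pd c << x *g m >> = x *: pd_monom c m.
Proof. by rewrite pdE mmapU mul_malgC. Qed.

Fact pd_is_additive c : additive (pd c).
Proof. by move=> p q; rewrite !pdE raddfB. Qed.
HB.instance Definition _ c := GRing.isAdditive.Build A A (pd c) (pd_is_additive c).

Lemma pdD c p q : pd c (p + q) = pd c p + pd c q.
Proof. exact: raddfD. Qed.

Lemma pd_monomM c m1 m2 :
  pd_monom c (mmul m1 m2) = pd_monom c m1 * << m2 >> + << m1 >> * pd_monom c m2.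
Proof.
have div_l (n1 n2 : monom) : n1 c != 0%N ->
    divcm (mmul n1 n2) (ucm c) = mmul (divcm n1 (ucm c)) n2.
  move=> n1c; apply/eqP/cmP => i; rewrite divcmE !cmM divcmE ucmE addnBAC //.
  by case: eqP => // <-; rewrite lt0n.
have term (n1 n2 : monom) : << (n1 c)%:R *g divcm (mmul n1 n2) (ucm c) >> = pd_monom c n1 * << n2 >>.
  rewrite /pd_monom malgMUU mulr1; have [->|/div_l->//] := eqVneq (n1 c) 0%N.
  by rewrite !monalgU0.
rewrite /pd_monom cmM natrD monalgUD term; congr (_ + _).
by rewrite (mulmC m1) (term m2 m1) [RHS]mulrC.
Qed.

Lemma pdM c p q : pd c (p * q) = pd c p * q + p * pd c q.
Proof.
elim/malg_ind: p => [x m1|p1 p2 IH1 IH2]; last first.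
  exact: leibniz_addl (pdD c) IH1 IH2.
elim/malg_ind: q => [y m2|q1 q2 IH1 IH2]; last first.
  exact: leibniz_addr (pdD c) IH1 IH2.
have mE (z : rat) m : << z *g m >> = z *: (<< m >> : A).
  by rewrite -mul_malgC malgMUU mul1m mulr1.
apply: (leibniz_scale (pdU c x m1) (mE x m1) (pdU c y m2) (mE y m2)).
apply: etrans (congr1 (pd c) (malgMUU x y m1 m2)) _.
apply: etrans (pdU c (x * y) (mmul m1 m2)) _.
exact: (congr1 ( *:%R (x * y)) (pd_monomM c m1 m2)).
Qed.

Lemma varsP c p : c \notin vars p -> pd c p = 0.
Proof.
rewrite mem_undup => cNp; apply: big1_seq => m /= mp.
suff -> : (m : monom) c = 0%N by rewrite mulr0 monalgU0.
apply/eqP; rewrite cmE_eq0; apply: contra cNp => cm.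
by apply/flattenP; exists (enum_fset (finsupp m)) => //; apply: map_f.
Qed.

(** Surplus coordinates contribute zero, so the values at several polynomials can be summed over one
    common list. *)
Lemma vfieldE (d : seq coord) a p : uniq d -> {subset vars p <= d} ->
  vfield a p = \sum_(c <- d) a c * pd c p.
Proof.
move=> ud sd; rewrite [RHS](bigID (mem (vars p))) /= [X in _ + X]big1 ?addr0.
  rewrite -big_filter; apply: perm_big; apply: uniq_perm.
  - exact: undup_uniq.
  - exact: filter_uniq.
  - by move=> c; rewrite mem_filter andb_idr // => /sd.
by move=> c /varsP->; rewrite mulr0.
Qed.

Lemma vfield_derivation a : derivation (vfield a).
Proof.
have sub3 p q r (d := undup (vars p ++ vars q ++ vars r)) : [/\ uniq d,
    {subset vars p <= d}, {subset vars q <= d} & {subset vars r <= d}].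
  split=> [|c c_v|c c_v|c c_v]; first exact: undup_uniq.
  - by rewrite (mem_undup (vars p ++ _)) !mem_cat c_v.
  - by rewrite (mem_undup (vars p ++ _)) !mem_cat c_v orbT.
  - by rewrite (mem_undup (vars p ++ _)) !mem_cat c_v !orbT.
split=> p q.
  have [ud s1 s2 s3] := sub3 (p + q) p q.
  rewrite (vfieldE a ud s1) (vfieldE a ud s2) (vfieldE a ud s3) -big_split /=.
  by apply: eq_bigr => c _; rewrite pdD mulrDr.
have [ud s1 s2 s3] := sub3 (p * q) p q.
rewrite (vfieldE a ud s1) (vfieldE a ud s2) (vfieldE a ud s3) mulr_suml mulr_sumr.
rewrite -big_split /=.
apply: eq_bigr => c _; exact: leibniz_mul (pdM c p q).
Qed.

Lemma pd_var c d : pd c (var d) = (c == d)%:R.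
Proof.
rewrite pdU scale1r /pd_monom ucmE eq_sym.
case: eqVneq => [->|_]; last exact: monalgU0.
suff -> : divcm (ucm d) (ucm d) = mone by [].
by apply/eqP/cmP => i; rewrite divcmE subnn cm1.
Qed.

Lemma vfield_var a c : vfield a (var c) = a c.
Proof.
have vc d : (d \in vars (var c)) = (d \in [:: c]).
  rewrite mem_undup /var msuppU1 inE.
  apply/flatten_mapP/eqP => [[m] mc|->].
    have /eqP-> : m == ucm c by rewrite -in_fset1; exact: mc.
    by rewrite -[d \in _]/(d \in finsupp (ucm c)) mdomU in_fset1 => /eqP.
  exists (ucm c); first by rewrite -[_ \in _]/(_ \in [fset _]%fset) in_fset1.
  by rewrite -[c \in _]/(c \in finsupp (ucm c)) mdomU in_fset1.
rewrite (@vfieldE [:: c]) // => [|d]; last by rewrite vc.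
by rewrite big_seq1 pd_var eqxx mulr1.
Qed.

(** Integers are killed because 1 is; for a fraction, apply [D] to its product with the denominator
    and cancel the denominator. *)
Lemma derivation_const (D : A -> A) (x : rat) : derivation D -> D x%:MP = 0.
Proof.
move=> dD; have dN n : D n%:R = 0 by rewrite (derMn dD) (der1 dD) mul0rn.
have dZ n : D n%:~R = 0.
  case: n => n; first exact: dN.
  by rewrite NegzE mulrNz (derN dD); apply/eqP; rewrite oppr_eq0; apply/eqP/dN.
pose d : rat := (denq x)%:~R; have d0 : d != 0 by rewrite intr_eq0 denq_neq0.
have := dZ (numq x); rewrite -(rmorph_int (@malgC monom rat)) numqE rmorphM.
rewrite (derM dD) [X in _ * D X]rmorph_int dZ mulr0 addr0 => /= e.
by rewrite -[LHS]mulr1 -(@rmorph1 _ _ (@malgC monom rat)) -(divff d0) rmorphM mulrA e mul0r.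
Qed.

(** Reduces commutation of vector fields to a check on coordinates. Monomials are treated by
    induction on the degree, splitting off one coordinate. *)
Lemma derivation_eq0 (D : A -> A) : derivation D -> (forall c, D (var c) = 0) ->
  forall p, D p = 0.
Proof.
move=> dD D0; elim/malg_ind => [x m|p q IHp IHq]; last by rewrite (derD dD) IHp IHq addr0.
have -> : << x *g m >> = x%:MP * << m >> :> A by rewrite malgMUU mulr1 mul1m.
apply: (derM_eq0 dD); first exact: derivation_const.
have [n] := ubnP (mdeg m); elim: n => // n IH in m *.
have [-> _|/eqP m1] := eqVneq m mone.
  by rewrite -/(malgC 1) rmorph1 (der1 dD).
have [c mc] : exists c, m c != 0%N.
  apply: contrapT => /forallNP m0; apply: m1; apply/eqP/cmP => c.
  by apply/eqP; rewrite cm1 -[_ == _]negbK; apply/negP/m0.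
pose m' := divcm m (ucm c).
have -> : m = mmul (ucm c) m'.
  apply/eqP/cmP => i; rewrite cmM divcmE ucmE subnKC //.
  by case: eqP => // <-; rewrite lt0n.
rewrite mdegM mdegU ltnS => lt_m'.
have -> : << mmul (ucm c) m' >> = var c * << m' >> :> A by rewrite malgMUU mulr1.
by apply: (derM_eq0 dD) (D0 c) (IH _ lt_m').
Qed.

Lemma vfield_comm a b : (forall c, vfield a (b c) = vfield b (a c)) ->
  forall p, vfield a (vfield b p) = vfield b (vfield a p).
Proof.
move=> ab p; apply/subr0_eq; move: p; apply: derivation_eq0.
  by apply: commutator_derivation; exact: vfield_derivation.
by move=> c; rewrite !vfield_var ab subrr.
Qed.
End PolynomialDerivations.

(** * Laurent series as shifted power series *)

Section LaurentBridge.
Implicit Types (F G : laurent) (k : nat).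

Lemma lamX_lser k F j :
  (lam ^+ k * (lser F : fps A)) j = lcoef F (j%:Z - (k + lord F)%N%:Z).
Proof.
rewrite lamXE /lcoef PoszD opprD addrA addrNK.
case: leqP => [le_kj|lt_jk]; first by rewrite subzn.
have -> : j%:Z - k%:Z = Negz (k - j).-1 by lia.
by [].
Qed.

(** Cross-multiplication by the orders turns an equality of Laurent series into one of power
    series. *)
Lemma lcoef_inj F G : (forall i, lcoef F i = lcoef G i) ->
  lam ^+ lord G * (lser F : fps A) = lam ^+ lord F * (lser G : fps A).
Proof. by move=> eqFG; apply: fpsP => j; rewrite !lamX_lser eqFG addnC. Qed.

Lemma lser_add F G : lser (ladd F G) =
  lam ^+ lord G * (lser F : fps A) + lam ^+ lord F * (lser G : fps A) :> fps A.
Proof. by apply: fpsP => j; rewrite fpsDE !lamX_lser [(lord G + _)%N]addnC. Qed.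

Lemma lcoef_add F G i : lcoef (ladd F G) i = lcoef F i + lcoef G i.
Proof.
rewrite {1}/lcoef /=; case e: (i + _) => [j|j].
  by rewrite -e addrK.
have neg H : (lord H <= lord F + lord G)%N -> lcoef H i = 0.
  rewrite /lcoef; case e': (i + _) => [l|//] leH; lia.
by rewrite !neg ?addr0 ?leq_addr ?leq_addl.
Qed.

Lemma lcoef_opp F i : lcoef (lopp F) i = - lcoef F i.
Proof. by rewrite /lcoef /=; case: (_ + _) => // _; rewrite oppr0. Qed.

Lemma lser_const c : lser (lconst c) = cst c :> fps A.
Proof. by []. Qed.

Lemma lord_pow F k : lord (lpow F k) = (k * lord F)%N.
Proof. by elim: k => //= k ->. Qed.

Lemma lser_pow F k : lser (lpow F k) = (lser F : fps A) ^+ k :> fps A.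
Proof.
elim: k => [|k IH]; first exact: etrans (lser_const 1) (rmorph1 _).
by rewrite exprS -IH.
Qed.

(** The regular part of phi; the polar part 1/lam becomes the summand 1 of [uSer]. *)
Definition Phi_ser : fps A := phik.
Definition uSer : fps A := 1 + lam * Phi_ser.

Lemma lser_phiL : lser phiL = uSer :> fps A.
Proof. by apply: fpsP => -[|j]; rewrite /uSer fpsDE fps1E lamME /= ?addr0 ?add0r. Qed.

Lemma lser_phiLam : lser phiLam = lam * dlam uSer - uSer :> fps A.
Proof.
apply: fpsP => -[|j]; rewrite fpsBE lamME /uSer /dlam !fpsDE !fps1E !lamME /=.
  by rewrite addr0 sub0r.
by rewrite !add0r mulrS mulrDl mul1r [X in _ = X - _]addrC addrK.
Qed.

(* [reduce] subtracts a polynomial in phi, at most of the degree allowed by the order. *)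
Lemma lser_reduce k F : exists d H,
  [/\ lord (reduce k F) = (d + lord F)%N, homog uSer (lord (reduce k F)) H &
    lser (reduce k F) = lam ^+ d * (lser F : fps A) - H :> fps A].
Proof.
have step i G (c := lcoef G (- i%:Z))
    (G' := ladd G (lopp (lscale c (lpow phiL i)))) :
  exists d H, [/\ lord G' = (d + lord G)%N, homog uSer (lord G') H &
    lser G' = lam ^+ d * (lser G : fps A) - H :> fps A].
  have lG' : lord G' = (lord G + i)%N by rewrite /= lord_pow muln1.
  (* [ladd] adds the orders, so subtracting c phi^i raises the order by [i] and shifts the series of
     [G] by lam^i. *)
  exists i, (lam ^+ lord G * (cst c * uSer ^+ i)); split; first by rewrite lG' addnC.
    rewrite lG'; apply: homog_lamX; apply: homogZ.
    by have := homogX i (homog_uE uSer); rewrite mul1n.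
  have lN : lord (lopp (lscale c (lpow phiL i))) = i by rewrite /= lord_pow muln1.
  have sN : lser (lopp (lscale c (lpow phiL i))) = - (cst c * uSer ^+ i) :> fps A.
    by rewrite -lser_phiL -lser_pow -lser_const.
  by rewrite /G' lser_add sN lN mulrN.
elim: k F => [|k IH] F; first exact: (step 0 F).
have [d [H [lG hH sG]]] := step k.+1 F; set G := ladd _ _ in lG hH sG.
rewrite -[reduce k.+1 F]/(reduce k G).
have [d' [H' [-> hH' ->]]] := IH G; exists (d' + d)%N, (lam ^+ d' * H + H'); split.
- by rewrite lG addnA.
- by apply: homogD => //; exact: homog_lamX.
- by rewrite sG exprD; ring.
Qed.

(** Since phi^k starts with lam^(-k) with coefficient 1, subtracting c phi^k clears that coefficient
    and leaves the lower powers at zero. The descent ends with the constant term. *)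
Lemma lcoef_reduce k F : (forall i : nat, (k < i)%N -> lcoef F (- i%:Z) = 0) ->
  forall i : nat, lcoef (reduce k F) (- i%:Z) = 0.
Proof.
have pow_coef (j i : nat) a : (j <= i)%N ->
    lcoef (lscale a (lpow phiL j)) (- i%:Z) = if i == j then a else 0.
  move=> le_ji; rewrite /lcoef /= lord_pow muln1 add0n.
  case: eqVneq => [->|ne_ij]; last by case e: (_ + _) => [l|//]; lia.
  rewrite addNr -[LHS]/(((cst a : fps A) * lser (lpow phiL j)) 0) cstME lser_pow.
  rewrite lser_phiL; suff -> : (uSer ^+ j) 0 = 1 by rewrite mulr1.
  elim: (j) => // n IH; rewrite exprS fpsM0E IH mulr1.
  by rewrite /uSer fpsDE fps1E lamME addr0.
have step (j : nat) G (c := lcoef G (- j%:Z)) :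
    (forall i : nat, (j < i)%N -> lcoef G (- i%:Z) = 0) ->
    forall i : nat, (j <= i)%N ->
      lcoef (ladd G (lopp (lscale c (lpow phiL j)))) (- i%:Z) = 0.
  move=> G0 i le_ji; rewrite lcoef_add lcoef_opp pow_coef //.
  case: eqVneq => [->|ne_ij]; first by rewrite subrr.
  by rewrite G0 ?subr0 // ltn_neqAle eq_sym ne_ij.
elim: k F => [|k IH] F F0 i; first exact: step.
by apply: IH => // j lt_kj; apply: step.
Qed.

End LaurentBridge.

Lemma derN_eq0 (B : comNzRingType) (D : B -> B) a :
  derivation D -> D a = 0 -> D (- a) = 0.
Proof. by move=> dD Da; rewrite (derN dD) Da oppr0. Qed.

(** * The covering equations and the projection in terms of power series *)

Section CoveringEquations.
Variables (B : comNzRingType) (u p : fps B) (a b : B).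
Let w : fps B := u - cst a * lam.
Let Q : fps B := u * w - cst b * lam ^+ 2.
(** The series that Laurent arithmetic yields for [Qphi]: orders add up to 3 instead of 2, hence a
    surplus factor [lam]. The explicit powers of [lam] match the orders of the summands. *)
Let Q3 : fps B := lam ^+ 0 * (lam ^+ 1 * (u * u) + lam ^+ 2 * (cst (- a) * u))
  + lam ^+ 3 * cst (- b).

Let Q3E : Q3 = lam ^+ 1 * Q.
Proof. by rewrite /Q3 /Q /w !rmorphN; ring. Qed.

Lemma cancel_x : lam ^+ 0 * (Q3 * p) = lam ^+ 3 * cst (-1) -> Q * p = - lam ^+ 2.
Proof.
move=> e; apply: (@lamX_inj B 1); rewrite mulrA -Q3E -[LHS]mul1r.
by rewrite -[1](expr0 lam) e rmorphN rmorph1; ring.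
Qed.

Lemma cancel_y : lam ^+ 1 * (Q3 * p) =
  lam ^+ 3 * - (lam ^+ 0 * u + lam ^+ 1 * cst (- a)) -> Q * p = - (lam * w).
Proof.
move=> e; apply: (@lamX_inj B 2); rewrite [LHS]mulrA.
have -> : lam ^+ 2 * Q = lam ^+ 1 * Q3 by rewrite Q3E; ring.
by rewrite -mulrA e rmorphN /w; ring.
Qed.
End CoveringEquations.

Lemma shift_subst (B : comNzRingType) (v F G H : fps B) d k :
  F = lam ^+ k * v -> G = lam ^+ d * F - H -> G = lam ^+ (d + k) * v - H.
Proof. by move=> -> ->; rewrite mulrA -exprD. Qed.

(** Provides the hypothesis [fE], with [K] the order of the projected Laurent series. *)
Lemma fcoef_form n : exists K e F, homog uSer K F /\
  lam ^+ K * (fcoef n : fps A) = lam ^+ e * (lam * dlam uSer - uSer) - F.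
Proof.
pose G := ltimesX n phiLam.
have [k Gk] : exists k, lser G = lam ^+ k * (lam * dlam uSer - uSer) :> fps A.
  rewrite -lser_phiLam /G; case: (n) => k.
    by exists k; apply: fpsP => j; rewrite lamXE.
  by exists 0; apply: fpsP => j; rewrite lamXE subn0.
have [d [H [_ hH sH]]] := lser_reduce (lord G) G.
exists (lord (frakP G)), (d + k)%N, H; split; first exact: hH.
apply: etrans _ (shift_subst Gk sH).
apply: fpsP => j; rewrite -[reduce _ _]/(frakP G).
have -> : lser (frakP G) j = lcoef (frakP G) (j%:Z - (lord (frakP G))%:Z).
  by rewrite /lcoef addrNK.
rewrite lamXE.
case: leqP => [le_j|lt_j]; first by rewrite /fcoef subzn.
rewrite -[frakP G]/(reduce (lord G) G).
(* Below index [K] stand the coefficients of negative powers of lam, all cleared by [reduce]. *)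
have -> : j%:Z - (lord (frakP G))%:Z = - (lord (frakP G) - j)%N%:Z by lia.
by rewrite lcoef_reduce // => i lt_i; rewrite /lcoef; case e: (_ + _) => [l|//]; lia.
Qed.

Lemma fcoef0 n : fcoef n 0 = 0.
Proof.
rewrite -[fcoef n 0]/(lcoef (reduce _ _) (- 0%N%:Z)) lcoef_reduce // => i lt_i.
by rewrite /lcoef; case e: (_ + _) => [l|//]; lia.
Qed.

Lemma der_scale (D : A -> A) (x : rat) (p : A) : derivation D -> D (x *: p) = x *: D p.
Proof.
move=> dD; rewrite -!mul_malgC; apply: etrans (derM dD _ _) _.
by rewrite derivation_const // mul0r add0r.
Qed.

Lemma der_half_sqr (D : A -> A) (p : A) : derivation D ->
  D (2%:R^-1 *: (p * p)) = p * D p.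
Proof.
move=> dD; rewrite der_scale //.
have -> : D (p * p) = 2%:R *: (p * D p).
  rewrite (derM dD p p) [D p * p]mulrC -mulr2n.
  by rewrite [RHS]scaler_nat.
by rewrite scalerA mulVf // scale1r.
Qed.

Lemma pd_derivation c : derivation (pd c).
Proof. by split; [exact: pdD | exact: pdM]. Qed.

(** * The x-derivatives of z_yy *)

Lemma der_eq0_zyy (B : comNzRingType) (D : B -> B) a b c d : derivation D ->
  D a = 0 -> D b = 0 -> D c = 0 -> D d = 0 -> D (a * b - c * d - 1) = 0.
Proof.
move=> dD Da Db Dc Dd; rewrite !(derB dD) !(derM dD) (der1 dD) Da Db Dc Dd; ring.
Qed.

Lemma vfield_ext a b p : (forall c, a c = b c \/ pd c p = 0) ->
  vfield a p = vfield b p.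
Proof.
by move=> ab; apply: eq_bigr => c _; case: (ab c) => ->; rewrite ?mulr0.
Qed.

(** The coefficients of [Dx] contain no phi^(k), so [pd (cphi k)] commutes with [Dx], and it kills
    [zyy]. *)
Lemma pd_cphi_Dx k a : pd (cphi k) (iter a Dx zyy) = 0.
Proof.
elim: a => [|a IH].
  by apply: (der_eq0_zyy (pd_derivation _)); exact: pd_var.
have comm q : pd (cphi k) (Dx q) = Dx (pd (cphi k) q).
  apply/subr0_eq; move: q; apply: derivation_eq0.
    apply: commutator_derivation (pd_derivation _) _; exact: vfield_derivation.
  move=> c; rewrite /Dx vfield_var pd_var.
  have -> : vfield Dx_coef (cphi k == c)%:R = 0.
    have dV := vfield_derivation Dx_coef.
    by case: (_ == _); [exact: der1|exact: der0].
  rewrite subr0; case: c => [[[]|[]]|[[i b]|i]].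
  - exact: der1 (pd_derivation _).
  - exact: der0 (pd_derivation _).
  - exact: pd_var.
  - exact: der0 (pd_derivation _).
by rewrite iterS comm IH; exact: der0 (vfield_derivation _).
Qed.

(** Bridges [Dy_coef], written with [Dx], and the total derivative of the covering. *)
Lemma Dxt_iter_Dx phix a : Dxt phix (iter a Dx zyy) = iter a.+1 Dx zyy.
Proof.
rewrite iterS; apply: vfield_ext => -[[[]|[]]|[[i b]|k]]; try by left.
by right; exact: pd_cphi_Dx.
Qed.

(** * The low coefficients phi^(0), ..., phi^(3) *)

Lemma phi3_eq0 (B : comNzRingType) (s3 s y sy : B) :
  s3 = - s - y * sy -> s = 0 -> sy = 0 -> s3 = 0.
Proof. by move=> -> -> ->; rewrite mulr0 subr0 oppr0. Qed.

Lemma der_phi3 (F : A -> A) : derivation F -> F (phik 3) = - F z0 - Y * F Y.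
Proof.
move=> dF; apply: etrans (derB dF _ _) _.
by rewrite (der_half_sqr Y dF) (derN dF z0).
Qed.

Lemma fps_lincombP (B : comNzRingType) (s f p q : fps B) a b :
  (forall k, s k = f k + a * p k + b * q k) -> s = f + cst a * p + cst b * q.
Proof. by move=> e; apply: fpsP => k; rewrite !fpsDE !cstME. Qed.

Lemma phi0_identity (B : comNzRingType) (s d e f0 f1 f2 : B) :
  s = 0 -> d = 0 -> e = 0 -> f0 = 0 -> s = f0 + f2 * d + f1 * e.
Proof. by move=> -> -> -> ->; ring. Qed.

Lemma phi1_identity (B : comNzRingType) (s d e : B -> B) y f1 f2 :
  derivation s -> derivation d -> derivation e -> s y = 0 -> d y = 0 -> e y = 1 ->
  s (- y) = f1 + f2 * d (- y) + f1 * e (- y).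
Proof.
by move=> ds dd de sy dy ey; rewrite (derN ds) (derN dd) (derN de) sy dy ey; ring.
Qed.

Lemma phi2_identity (B : comNzRingType) (s d e : B -> B) x f1 f2 :
  derivation s -> derivation d -> derivation e -> s x = 0 -> d x = 1 -> e x = 0 ->
  s (- x) = f2 + f2 * d (- x) + f1 * e (- x).
Proof.
by move=> ds dd de sx dx ex; rewrite (derN ds) (derN dd) (derN de) sx dx ex; ring.
Qed.

(** This dictates the formula for [Zgen]: with [s] the generator, [p] = z_x and [q] = z_y, the
    formula for S phi holds at phi^(3). *)
Lemma phi3_identity (B : comNzRingType) (s3 d3 e3 s d e y sy dy ey p q f1 f2 f3 : B) :
  s3 = - s - y * sy -> d3 = - d - y * dy -> e3 = - e - y * ey ->
  s = (q + y) * f1 + p * f2 - f3 -> sy = 0 -> d = p -> dy = 0 -> e = q -> ey = 1 ->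
  s3 = f3 + f2 * d3 + f1 * e3.
Proof. by move=> -> -> -> -> -> -> -> -> ->; ring. Qed.

(** These phi^(k) are polynomials in x, y, z. Applied to commutators, this gives order at least 4 in
    lam. *)
Lemma der_phi_lt4 (F : A -> A) i : derivation F -> F X = 0 -> F Y = 0 ->
  F z0 = 0 -> (i < 4)%N -> F (phik i) = 0.
Proof.
move=> dF FX FY Fz; case: i => [|[|[|[|i]]]] lt_i4.
- exact: (der0 dF).
- exact: derN_eq0 dF FY.
- exact: derN_eq0 dF FX.
- exact: phi3_eq0 (der_phi3 dF) Fz FY.
- exact: (False_ind _ (notF lt_i4)).
Qed.

Lemma comm_eq0 (B : comNzRingType) (F G : B -> B) a b c d :
  G a = b -> F b = d -> F a = c -> G c = d -> F (G a) - G (F a) = 0.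
Proof. by move=> <- Fb <- Gc; rewrite Fb Gc subrr. Qed.

(** The Jacobi identity when [F] commutes with both [G] and [H]. *)
Lemma commutator_comm (B : comNzRingType) (F G H : B -> B) :
  derivation F -> (forall p, H (F p) = F (H p)) -> (forall p, F (G p) = G (F p)) ->
  forall p, G (H (F p)) - H (G (F p)) = F (G (H p) - H (G p)).
Proof. by move=> dF HF FG p; rewrite (derB dF) HF -!FG HF. Qed.

(** * The covering and the symmetry *)

Section Covering.
Variables (phix phiy : nat -> A).
Hypothesis cov : covering_eqs phix phiy.
Let D := Dxt phix.
Let E := Dyt phiy.
Let dD : derivation D. Proof. exact: vfield_derivation. Qed.
Let dE : derivation E. Proof. exact: vfield_derivation. Qed.
Let w : fps A := uSer - cst zx * lam.
Let Q : fps A := uSer * w - cst zy * lam ^+ 2.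

Let lser_addE F G m n (f g : fps A) : lord F = m -> lord G = n ->
  lser F = f -> lser G = g -> lser (ladd F G) = lam ^+ n * f + lam ^+ m * g :> fps A.
Proof. by move=> <- <- <- <-; exact: lser_add. Qed.

Let lser_mulE F G (f g : fps A) : lser F = f -> lser G = g ->
  lser (lmul F G) = f * g :> fps A.
Proof. by move=> <- <-. Qed.

Let lser_Qphi : lser Qphi = lam ^+ 0 * (lam ^+ 1 * (uSer * uSer)
  + lam ^+ 2 * (cst (- zx) * uSer)) + lam ^+ 3 * cst (- zy) :> fps A.
Proof.
apply: (@lser_addE (ladd (lmul phiL phiL) (lscale (- zx) phiL)) (lconst (- zy)) 3 0) => //.
apply: (@lser_addE (lmul phiL phiL) (lscale (- zx) phiL) 2 1).
- by [].
- by [].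
- exact: lser_mulE lser_phiL lser_phiL.
- exact: lser_mulE (lser_const _) lser_phiL.
Qed.

Lemma Q_phix : Q * dmap D Phi_ser = - lam ^+ 2.
Proof.
apply: cancel_x; apply: etrans (etrans _ (lcoef_inj cov.1)) _.
  by rewrite (lser_mulE lser_Qphi (erefl _)).
by [].
Qed.

Lemma Q_phiy : Q * dmap E Phi_ser = - (lam * w).
Proof.
have sR : lser (lopp (ladd phiL (lconst (- zx)))) =
    - (lam ^+ 0 * uSer + lam ^+ 1 * cst (- zx)) :> fps A.
  apply: etrans (_ : _ = - (lser (ladd phiL (lconst (- zx))) : fps A)) _; first by [].
  by rewrite (@lser_addE phiL (lconst (- zx)) 1 0 uSer (cst (- zx)) erefl erefl lser_phiL erefl).
apply: cancel_y; apply: etrans (etrans _ (lcoef_inj cov.2)) _.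
  by rewrite (lser_mulE lser_Qphi (erefl _)).
by rewrite sR.
Qed.

Lemma D_Z a b : D (Z a b) = Z a.+1 b. Proof. exact: vfield_var. Qed.
Lemma E_Z0 a : E (Z a false) = Z a true. Proof. exact: vfield_var. Qed.
Lemma E_Z1 a : E (Z a true) = iter a Dx zyy. Proof. exact: vfield_var. Qed.
Lemma D_phi k : D (var (cphi k)) = phix k. Proof. exact: vfield_var. Qed.
Lemma E_phi k : E (var (cphi k)) = phiy k. Proof. exact: vfield_var. Qed.

Lemma E_zy : E zy = zy * D zx - zx * D zy - 1.
Proof.
apply: etrans (E_Z1 0) _.
exact: (f_equal2 (fun b d => zy * b - zx * d - 1)
  (esym (D_Z 1 false)) (esym (D_Z 0 true))).
Qed.

Lemma Ezx_Dzy : E zx = D zy.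
Proof. exact: etrans (E_Z0 1) (esym (D_Z 0 true)). Qed.

Lemma dmap_DE : dmap D (dmap E Phi_ser) = dmap E (dmap D Phi_ser).
Proof.
exact: (@phixy_comm A D E Phi_ser uSer w Q zx zy dD dE erefl erefl erefl
  Q_phix Q_phiy Ezx_Dzy E_zy).
Qed.

Lemma DE_comm p : D (E p) = E (D p).
Proof.
apply: vfield_comm => -[[[]|[]]|[[a [|]]|k]].
- exact: etrans (der0 dD) (esym (der1 dE)).
- exact: etrans (der1 dD) (esym (der0 dE)).
- exact: etrans (Dxt_iter_Dx _ _) (esym (E_Z1 _)).
- exact: etrans (D_Z _ _) (esym (E_Z0 _)).
- have e : D (E (var (cphi k))) = E (D (var (cphi k))).
    exact: (congr1 (fun s : fps A => s k.+4) dmap_DE).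
  by move: e; rewrite D_phi E_phi.
Qed.

(** * Commutation of S with the total derivatives *)

Section Symmetry.
Variable n : int.
Let S := Ssym phix phiy n.
Let dS : derivation S. Proof. exact: vfield_derivation. Qed.

Lemma S_X : S X = 0. Proof. exact: vfield_var. Qed.
Lemma S_Y : S Y = 0. Proof. exact: vfield_var. Qed.
Lemma S_Z a b : S (Z a b) = iter a D (iter b E (Zgen n)).
Proof. exact: vfield_var. Qed.
Lemma S_phi k : S (var (cphi k)) = Defs.PhiS phix phiy n k.
Proof. exact: vfield_var. Qed.
Lemma D_X : D X = 1. Proof. exact: vfield_var. Qed.
Lemma D_Y : D Y = 0. Proof. exact: vfield_var. Qed.
Lemma E_X : E X = 0. Proof. exact: vfield_var. Qed.
Lemma E_Y : E Y = 1. Proof. exact: vfield_var. Qed.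

(** From phi^(4) on this is the definition of [PhiS]; the four lower coefficients follow from the
    vanishing of f^(0), the action on y and x, and the choice of [Zgen]. *)
Lemma dmap_S : dmap S Phi_ser = (fcoef n : fps A)
  + cst (fcoef n 2) * dmap D Phi_ser + cst (fcoef n 1) * dmap E Phi_ser.
Proof.
apply: fps_lincombP => -[|[|[|[|k]]]].
- exact: phi0_identity (der0 dS) (der0 dD) (der0 dE) (fcoef0 n).
- exact: (phi1_identity _ _ dS dD dE S_Y D_Y E_Y).
- exact: (phi2_identity _ _ dS dD dE S_X D_X E_X).
- exact: phi3_identity (der_phi3 dS) (der_phi3 dD) (der_phi3 dE)
    (S_Z 0 false) S_Y (D_Z 0 false) D_Y (E_Z0 0) E_Y.
- have : S (var (cphi k)) = fcoef n (k + 4) + fcoef n 2 * D (var (cphi k))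
    + fcoef n 1 * E (var (cphi k)) by rewrite D_phi E_phi; exact: S_phi.
  by rewrite addn4.
Qed.

Let CD p := D (S p) - S (D p).
Let CE p := E (S p) - S (E p).
Let dCD : derivation CD. Proof. exact: (commutator_derivation dD dS). Qed.
Let dCE : derivation CE. Proof. exact: (commutator_derivation dE dS). Qed.

Lemma CD_Z a b : CD (Z a b) = 0.
Proof. exact: comm_eq0 (S_Z a b) (erefl _) (D_Z a b) (S_Z a.+1 b). Qed.
Lemma CD_X : CD X = 0.
Proof. exact: comm_eq0 S_X (der0 dD) D_X (der1 dS). Qed.
Lemma CD_Y : CD Y = 0.
Proof. exact: comm_eq0 S_Y (der0 dD) D_Y (der0 dS). Qed.
Lemma CE_X : CE X = 0.
Proof. exact: comm_eq0 S_X (der0 dE) E_X (der0 dS). Qed.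
Lemma CE_Y : CE Y = 0.
Proof. exact: comm_eq0 S_Y (der0 dE) E_Y (der1 dS). Qed.
Lemma CE_z : CE z0 = 0.
Proof. exact: comm_eq0 (S_Z 0 false) (erefl _) (E_Z0 0) (S_Z 0 true). Qed.

Lemma S_comm_phik : (dmap D (dmap S Phi_ser) - dmap S (dmap D Phi_ser) = 0) /\
  (dmap E (dmap S Phi_ser) - dmap S (dmap E Phi_ser) = 0).
Proof.
have [K [e [F [hF fE]]]] := fcoef_form n.
apply: (@S_comm_Phi A D E Phi_ser uSer w Q _ zx zy dD dE erefl erefl erefl erefl
  Q_phix Q_phiy S dS _ _ _ F K e dmap_DE fE hF dmap_S) => i lt_i4.
  exact: (der_phi_lt4 dCD CD_X CD_Y (CD_Z _ _) lt_i4).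
exact: (der_phi_lt4 dCE CE_X CE_Y CE_z lt_i4).
Qed.

Lemma SD_comm p : S (D p) = D (S p).
Proof.
apply/esym/subr0_eq; move: p; apply: (derivation_eq0 dCD) => -[[[]|[]]|[[a b]|k]].
- exact: CD_X.
- exact: CD_Y.
- exact: CD_Z.
- exact: (congr1 (fun s : fps A => s k.+4) S_comm_phik.1).
Qed.

Lemma CE_D p : CE (D p) = D (CE p).
Proof. exact: (commutator_comm dD SD_comm DE_comm). Qed.

Lemma CE_Phi : dmap CE Phi_ser = 0.
Proof. exact: S_comm_phik.2. Qed.

Lemma CE_phix : dmap CE (dmap D Phi_ser) = 0.
Proof.
apply: fpsP => i; rewrite !dmapE CE_D.
have -> : CE (Phi_ser i) = 0 by exact: (congr1 (fun s : fps A => s i) CE_Phi).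
exact: der0.
Qed.

Lemma CE_zy : CE zy = 0.
Proof.
exact: (@der_zxy0 A D Phi_ser uSer w Q zx zy erefl erefl erefl
  Q_phix CE dCE CE_Phi CE_phix).2.
Qed.

Lemma SE_comm p : S (E p) = E (S p).
Proof.
apply/esym/subr0_eq; move: p; apply: (derivation_eq0 dCE) => -[[[]|[]]|[[a b]|k]].
- exact: CE_X.
- exact: CE_Y.
- change (CE (Z a b) = 0).
  (* Each further x-derivative is [D] of the previous coordinate, and [CE] commutes with [D]. *)
  elim: a => [|a IH]; first by case: b; [exact: CE_zy | exact: CE_z].
  by rewrite -D_Z CE_D IH; exact: der0.
- exact: (congr1 (fun s : fps A => s k.+4) S_comm_phik.2).
Qed.
End Symmetry.
End Covering.

(* For every integer n and for the (uniquely determined) functions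
   phi^(k)_x, phi^(k)_y defining the covering \bar\tau_*, the vector field S
   commutes with both total derivatives of the covering. *)
Theorem mainTheorem2 (n : int) (phix phiy : nat -> A) :
  covering_eqs phix phiy ->
  (forall p : A, Ssym phix phiy n (Dxt phix p) = Dxt phix (Ssym phix phiy n p)) /\
  (forall p : A, Ssym phix phiy n (Dyt phiy p) = Dyt phiy (Ssym phix phiy n p)).
Proof.
by move=> cov; split=> p; [exact: SD_comm|exact: SE_comm].
Qed.
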